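(* Let $n\geq 4$ be an integer. Every simple arrangement of $n$ lines in $\mathbb{R}^2$ has at least $2(n-1)$ external facets.
   Context: An arrangement $\mathcal{A}_{d,n}$ of $n$ (distinct) hyperplanes (affine, in $\mathbb{R}^d$) is called simple if $n\geq d+1$ and any $d$ of the hyperplanes intersect at a distinct point (i.e. any $d$ hyperplanes meet in exactly one point, and different choices of $d$ hyperplanes give different points). For $d=2$ this means $n\ge 3$, any two lines meet in exactly one point, and no three lines share a point. The cells of the arrangement are the closures of the connected components of the complement of the union of the hyperplanes. For $k=0,\dots,d-1$, the $k$-faces of the arrangement are the $k$-faces of its cells (each cell being a polyhedron). A facet of the arrangement is a $(d-1)$-face; for $d=2$ the facets are the (bounded or unbounded) edges into which the lines are divided by the intersection points. A facet is called external if it belongs to exactly one bounded cell; equivalently, it is a bounded facet which belongs to an unbounded cell. *)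

(* Defs.v *)
From HB Require Import structures.
From mathcomp Require Import all_boot all_order all_algebra.
From mathcomp Require Import all_classical all_reals all_analysis.

Set Implicit Arguments.
Unset Strict Implicit.
Unset Printing Implicit Defensive.

Import Order.TTheory GRing.Theory Num.Theory.
Import numFieldNormedType.Exports.

Local Open Scope classical_set_scope.
Local Open Scope ring_scope.

Section Arrangements.
Context {R : realType} {d : nat}.
Implicit Types (P C F : set 'rV[R]_d).

Definition dotp (u v : 'rV[R]_d) : R := \sum_(i < d) u 0 i * v 0 i.

Definition hyperplane P : Prop :=
  exists (c : 'rV[R]_d) (b : R), c != 0 /\ P = [set x | dotp c x = b].

Definition affinely_independent k (p : 'I_k.+1 -> 'rV[R]_d) : bool :=
  row_free (\matrix_(i < k) (p (lift ord0 i) - p ord0)).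

(* The affine hull of P has dimension k; in particular P is nonempty. *)
Definition has_affine_dim P (k : nat) : Prop :=
  (exists p : 'I_k.+1 -> 'rV[R]_d,
     (forall i, P (p i)) /\ affinely_independent p) /\
  (forall p : 'I_k.+2 -> 'rV[R]_d,
     (forall i, P (p i)) -> ~~ affinely_independent p).

(* Intersection of P with the boundary of a valid inequality. The inequality
   may be trivial (c = 0), so that P is a face of itself. *)
Definition face P F : Prop :=
  exists (c : 'rV[R]_d) (b : R),
    (forall x, P x -> dotp c x <= b) /\ F = P `&` [set x | dotp c x = b].

Definition kface (k : nat) P F : Prop := face P F /\ has_affine_dim F k.

Section Arrangement.
Context {n : nat}.
Variable H : 'I_n -> set 'rV[R]_d.

Definition arrangement : Prop := (forall i, hyperplane (H i)) /\ injective H.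

Definition meet_of (J : {set 'I_n}) : set 'rV[R]_d :=
  \bigcap_(i in [set` J]) H i.

Definition simple_arrangement : Prop :=
  [/\ arrangement,
      (d.+1 <= n)%N,
      forall J : {set 'I_n}, #|J| = d -> exists x, meet_of J = [set x]
    & forall J K : {set 'I_n}, #|J| = d -> #|K| = d -> J != K ->
        meet_of J <> meet_of K].

Definition arr_complement : set 'rV[R]_d := ~` (\bigcup_i H i).

Definition cell C : Prop :=
  exists2 x, arr_complement x &
    C = closure (connected_component arr_complement x).

Definition arr_kface (k : nat) F : Prop := exists2 C, cell C & kface k C F.

Definition arr_facet F : Prop := arr_kface d.-1 F.

Definition external_facet F : Prop :=
  arr_facet F /\
  exists! C, [/\ cell C, bounded_set C & kface d.-1 C F].

End Arrangement.
End Arrangements.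

(* Main.v *)
Require Import Defs.
From mathcomp Require Import all_boot all_order all_algebra.
From mathcomp Require Import all_classical all_reals all_analysis.
From mathcomp Require Import ring lra zify.

(** Sort the [n] lines by angle and orient each of them. Repeating the list
    with all orientations reversed gives lines numbered by all natural numbers,
    [f_(k+n) = - f_k], whose directions turn counterclockwise, by a half turn
    every [n] steps. The ray at infinity in direction [r] and the next one
    bound an unbounded cell [C_r], the set where [f_k <= 0] for
    [r < k <= r + n]; these are the [2n] unbounded cells.

    Let [phi r] be the number, taken in the interval from [r] to [r + n], of
    the line that crosses line [r] last, that is, where the ray of [r] begins.
    If [phi r = r + 1], the two rays start at the same point and [C_r] is a
    wedge without bounded edges. Otherwise the bounded edges of [C_r] form a
    chain whose first edge is on line [phi r] and whose last one is on line
    [phi (r + 1)], so that [C_r] has at least one bounded edge, and at least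
    two if [phi r <> phi (r + 1)]. Such an edge is external: beyond it lies a
    cell contained in the triangle cut out by the lines [r], [r + 1] and the
    line of the edge ([zone_edge_external]). A bounded edge determines the
    unbounded cell it belongs to ([zone_edge_neq]), hence nothing is counted
    twice. With [w] wedges, and [q] non-wedges where [phi] changes, there are
    thus at least [2n - w + q] external facets, and it remains to see that
    [w <= q + 2].

    This is a discrete computation of the turning number of the boundary of the
    union of the bounded cells, where [phi] plays the part of the lifted tangent
    angle. Over a full turn [phi] grows by [2n]. At a wedge it jumps from
    [r + 1] to [r + n], so it gains [n - 1] ([last_crossing_wedge]). At any
    other cell the chain is reflex: [phi] does not increase, and it loses at
    most [n - 3] because both of its values lie strictly between [r + 1] and
    [r + n] ([last_crossing_antitone]). Therefore
    [w (n - 1) <= 2n + q (n - 3)], which for [n >= 4] excludes [w >= q + 3]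
    ([bounded_edge_count]). *)

(** * Lines listed cyclically by angle *)

Section Determinants.
Set Implicit Arguments.
Unset Strict Implicit.
Import Order.TTheory GRing.Theory Num.Theory.
Local Open Scope ring_scope.
Context {R : realType} {I : Type}.
Variables a b t : I -> R.

Definition det2 (i j : I) : R := a i * b j - a j * b i.

(** This is the determinant of the coefficient rows of three lines: [det2 i j]
    times the value of the equation of line [k] at the crossing of [i] and
    [j]. *)
Definition det3 (i j k : I) : R :=
  a k * (t i * b j - t j * b i) + b k * (a i * t j - a j * t i)
  - t k * det2 i j.

Lemma det2C i j : det2 j i = - det2 i j.
Proof. by rewrite /det2; ring. Qed.

Lemma det3_swap23 i j k : det3 i k j = - det3 i j k.
Proof. by rewrite /det3 /det2; ring. Qed.

Lemma det3_swap12 i j k : det3 j i k = - det3 i j k.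
Proof. by rewrite /det3 /det2; ring. Qed.

(** Four equations of lines are linearly dependent, with the four [det3] as
    coefficients; this is the dependency paired with line [l] by [det2]. *)
Lemma det3_plucker i j k l :
  det3 j k l * det2 i l - det3 i k l * det2 j l + det3 i j l * det2 k l = 0.
Proof. by rewrite /det3 /det2; ring. Qed.

End Determinants.

(** A simple arrangement of the [n] lines [A k * x + B k * y = T k], [k < n],
    continued over two half turns and beyond by reversing orientations. Unlike
    a list sorted from 0 to [n - 1], it looks the same from every index, which
    spares all wrap-around cases. *)
Record cyclic_lines {R : realType} (n : nat) (A B T : nat -> R) : Prop :=
  CyclicLines {
  cyclicA : forall k, A (k + n)%N = (- A k)%R;
  cyclicB : forall k, B (k + n)%N = (- B k)%R;
  cyclicT : forall k, T (k + n)%N = (- T k)%R;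
  cyclic_det2 : forall i j, (i < j)%N -> (j < i + n)%N -> (0 < det2 A B i j)%R;
  cyclic_det3 : forall i j k, (i < j)%N -> (j < k)%N -> (k < i + n)%N ->
    det3 A B T i j k != 0%R }.

Section LastCrossings.
Set Implicit Arguments.
Unset Strict Implicit.
Import Order.TTheory GRing.Theory Num.Theory.
Local Open Scope ring_scope.
Context {R : realType} {n : nat} {A B T : nat -> R}.
Hypothesis cyc : cyclic_lines n A B T.
Local Notation det2 := (det2 A B).
Local Notation det3 := (det3 A B T).

Lemma det2_addn i j : det2 i (j + n) = - det2 i j.
Proof. by rewrite /det2 (cyclicA cyc) (cyclicB cyc); ring. Qed.

Lemma det3_addn i j k : det3 i j (k + n) = - det3 i j k.
Proof. by rewrite /det3 (cyclicA cyc) (cyclicB cyc) (cyclicT cyc); ring. Qed.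

Lemma det3_neq0 r j k : (r < j)%N -> (r < k)%N -> (j < r + n)%N ->
  (k < r + n)%N -> j != k -> det3 r j k != 0.
Proof.
move=> rj rk jr kr; case: ltngtP => // jk _.
  exact: (cyclic_det3 cyc).
by rewrite det3_swap23 oppr_eq0; apply: (cyclic_det3 cyc).
Qed.

(** [det3 r m k < 0] says that the crossing of [r] and [m] is on the negative
    side of line [k]. As one moves along line [r] in its direction
    [(B r, - A r)], the equation of such a [k] decreases, so this means that
    [k] was crossed before [m]. *)
Definition last_crossing (r m : nat) : Prop :=
  [/\ (r < m)%N, (m < r + n)%N &
      forall k, (r < k)%N -> (k < r + n)%N -> k != m -> det3 r m k < 0].

Lemma last_crossing_uniq r m m' :
  last_crossing r m -> last_crossing r m' -> m = m'.
Proof.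
move=> [rm mr Hm] [rm' mr' Hm']; apply/eqP/negPn/negP => mm'.
have := Hm _ rm' mr'; rewrite eq_sym => /(_ mm').
by have := Hm' _ rm mr mm'; rewrite det3_swap23; lra.
Qed.

Lemma last_crossing_addn2 r m : last_crossing r m ->
  last_crossing (r + 2 * n) (m + 2 * n).
Proof.
move=> [rm mr Hm]; split; try lia.
move=> k rk kr km.
have [k' kE] : exists k', k = (k' + n + n)%N by exists (k - n - n)%N; lia.
have : det3 r m k' < 0 by apply: Hm; lia.
rewrite kE !mulSn mul0n addn0 !addnA /det3 /det2.
by rewrite !(cyclicA cyc, cyclicB cyc, cyclicT cyc) !opprK.
Qed.

(** Up to a positive factor, [det3 r j k] is the difference of the parameters of
    the crossings of [k] and [j] along line [r]; the largest parameter wins. *)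
Lemma last_crossing_exists r : (1 < n)%N -> exists m, last_crossing r m.
Proof.
move=> n1.
have N0 : 0 < A r ^+ 2 + B r ^+ 2.
  have : 0 < det2 r r.+1 by apply: (cyclic_det2 cyc); lia.
  rewrite /det2 => d0; rewrite lt_neqAle addr_ge0 ?sqr_ge0 // andbT eq_sym.
  rewrite paddr_eq0 ?sqr_ge0 // !sqrf_eq0; apply/negP => /andP[/eqP a0 /eqP b0].
  by rewrite a0 b0 in d0; lra.
pose N := A r ^+ 2 + B r ^+ 2.
(* The parameter is counted from the foot of the perpendicular from 0. *)
pose pos j := (A j * (T r * A r / N) + B j * (T r * B r / N) - T j) / det2 r j.
have det3E j k : det2 r j != 0 -> det2 r k != 0 ->
    det3 r j k = det2 r j * det2 r k * (pos k - pos j).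
  rewrite /pos /N /det3 /det2 => d1 d2; field.
  by rewrite d1 d2 gt_eqF.
have [p np] : exists p, n = p.+2 by exists (n - 2)%N; lia.
have [i0 i0max] : exists i0 : 'I_p.+1,
    forall i : 'I_p.+1, pos (r.+1 + i)%N <= pos (r.+1 + i0)%N.
  pose i0 := [arg max_(i > (ord0 : 'I_p.+1)) pos (r.+1 + i)%N]%O.
  by exists i0 => i; rewrite /i0; case: arg_maxP => // j _; apply.
have i0_lt := ltn_ord i0.
exists (r.+1 + i0)%N; split; try lia.
move=> k rk kr ko.
have kp : (k - r.+1 < p.+1)%N by lia.
have le : pos k <= pos (r.+1 + i0)%N.
  by have := i0max (Ordinal kp); rewrite /= subnKC.
have d1 : 0 < det2 r (r.+1 + i0) by apply: (cyclic_det2 cyc); lia.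
have d2 : 0 < det2 r k by apply: (cyclic_det2 cyc); lia.
rewrite lt_neqAle; apply/andP; split.
  by apply: det3_neq0; rewrite 1?eq_sym //; lia.
by rewrite det3E ?gt_eqF // pmulr_rle0 ?mulr_gt0 // subr_le0.
Qed.

(** Both sides say that the crossing of lines [r] and [r + 1] is the last one
    along both rays; line [r] is seen from [r + 1] under the number [r + n]. *)
Lemma last_crossing_wedge r : (1 < n)%N ->
  last_crossing r r.+1 <-> last_crossing r.+1 (r + n).
Proof.
move=> n1.
have E k : det3 r.+1 (r + n) k = det3 r r.+1 k.
  by rewrite det3_swap23 det3_addn opprK det3_swap23 det3_swap12 opprK.
split=> -[lb ub H]; split; try lia; move=> k rk kr kn.
  by rewrite E; apply: H; lia.
by rewrite -E; apply: H; lia.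
Qed.

(** The boundary of a convex unbounded cell turns in only one direction. Were
    [m < m'], the dependency between the lines [r], [r + 1], [m], [m'] would
    write a multiple of the direction of [m'] as a positive combination of the
    three other directions, which all lie strictly to the right of it. *)
Lemma last_crossing_antitone r m m' :
  last_crossing r m -> last_crossing r.+1 m' ->
  m != r.+1 -> [/\ (r.+1 < m')%N, (m' < r + n)%N & (m' <= m)%N].
Proof.
move=> Hm Hm' mr.
have m'r : m' != (r + n)%N.
  apply: contraNneq mr => E; rewrite E in Hm'.
  have n1 : (1 < n)%N by case: Hm; lia.
  by rewrite (last_crossing_uniq Hm ((last_crossing_wedge r n1).2 Hm')).
case: Hm Hm' => rm mrn Hm [rm' mrn' Hm'].
split; try lia; rewrite leqNgt; apply/negP => mm'.
have h1 : det3 r m m' < 0 by apply: Hm; lia.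
have h2 : det3 r.+1 m' m < 0 by apply: Hm'; lia.
have h3 : det3 r.+1 m' (r + n) < 0 by apply: Hm'; lia.
rewrite det3_swap23 in h2; rewrite det3_addn det3_swap23 det3_swap12 in h3.
have d1 : 0 < det2 r m' by apply: (cyclic_det2 cyc); lia.
have d2 : 0 < det2 r.+1 m' by apply: (cyclic_det2 cyc); lia.
have d3 : 0 < det2 m m' by apply: (cyclic_det2 cyc); lia.
have := det3_plucker A B T r r.+1 m m'.
have : 0 < det3 r.+1 m m' * det2 r m' by apply: mulr_gt0 => //; lra.
have : 0 < - det3 r m m' * det2 r.+1 m' by apply: mulr_gt0 => //; lra.
have : 0 < det3 r r.+1 m' * det2 m m' by apply: mulr_gt0 => //; lra.
lra.
Qed.

(** * Counting the edges of the unbounded cells *)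

(** The summand is a lower bound for the number of bounded edges of the cell
    [C_r]: 0 for a wedge, 2 when the first and last bounded edges are on
    different lines, 1 otherwise. *)
Lemma bounded_edge_count (phi : nat -> nat) : (3 < n)%N ->
  (forall r, last_crossing r (phi r)) ->
  (2 * (n - 1) <= \sum_(r < 2 * n)
     ((phi r != r.+1) + ((phi r != r.+1) && (phi r != phi r.+1))))%N.
Proof.
move=> n3 phiP.
pose wedge r := phi r == r.+1.
pose bent r := (phi r != r.+1) && (phi r != phi r.+1).
have step r : (phi r + wedge r * (n - 1) <= phi r.+1 + bent r * (n - 3))%N.
  rewrite /wedge /bent; case: eqVneq => [w|nw] /=.
    rewrite (@last_crossing_uniq r.+1 (phi r.+1) (r + n)) ?w //; first by lia.
    by apply/last_crossing_wedge; [lia|rewrite -w].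
  have [] := last_crossing_antitone (phiP r) (phiP r.+1) nw.
  by have [] := phiP r; case: eqVneq => //=; lia.
have : (\sum_(r < 2 * n) (phi r + wedge r * (n - 1)) <=
         \sum_(r < 2 * n) (phi r.+1 + bent r * (n - 3)))%N.
  by apply: leq_sum => r _; apply: step.
rewrite !big_split /= -!big_distrl /=.
(* The sum of the increments telescopes to one full turn. *)
have -> : (\sum_(r < 2 * n) phi r.+1 = \sum_(r < 2 * n) phi r + 2 * n)%N.
  have -> : (2 * n = (2 * n).-1.+1)%N by lia.
  rewrite big_ord_recr big_ord_recl /= prednK; last lia.
  have -> : phi (2 * n)%N = (phi 0 + 2 * n)%N.
    apply: (@last_crossing_uniq (2 * n)); first exact: phiP.
    exact: (@last_crossing_addn2 0).
  by rewrite addnCA addnA addnC addnA.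
have : (\sum_(r < 2 * n) (phi r != r.+1) + \sum_(r < 2 * n) wedge r = 2 * n)%N.
  rewrite -big_split /= -[RHS]muln1 -[in RHS](card_ord (2 * n)) -sum_nat_const.
  by apply: eq_bigr => r _; rewrite /wedge; case: eqVneq.
set W := (\sum_(r < _) wedge _)%N; set Q := (\sum_(r < _) bent _)%N.
set P := (\sum_(r < _) (phi _ != _))%N => PW le.
rewrite -/Q leqNgt; apply/negP => lt.
have [k kn] : exists k, n = (k + 3)%N by exists (n - 3)%N; lia.
have k2 : (n - 1 = k + 2)%N by lia.
have k0 : (n - 3 = k)%N by lia.
have : ((Q + 3) * (k + 2) <= W * (k + 2))%N by rewrite leq_mul2r; lia.
move: le lt; rewrite k2 k0 !mulnDl !mulnDr; clearbody P Q W.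
by move: (\sum_(i < _) phi i)%N PW kn n3; clear => *; lia.
Qed.

End LastCrossings.

(** * Cells as sign regions *)

Section SignRegions.
Set Implicit Arguments.
Unset Strict Implicit.
Import Order.TTheory GRing.Theory Num.Theory numFieldNormedType.Exports.
Local Open Scope classical_set_scope.
Local Open Scope ring_scope.
Context {R : realType} {V : normedModType R} {I : Type}.
Variables (D : set I) (l : I -> V -> R).
Hypothesis l_cont : forall i, continuous (l i).
Hypothesis l_affine : forall i x y t,
  l i (x + t *: (y - x)) = l i x + t * (l i y - l i x).

Let avoid := [set x | forall i, D i -> l i x != 0].

Lemma segment_cont (x y : V) : continuous (fun t : R => x + t *: (y - x)).
Proof.
move=> t; apply: cvgD; first exact: cvg_cst.
by apply: cvgZ; [exact: cvg_id|exact: cvg_cst].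
Qed.

(** A connected set that avoids the zeros of an affine function lies on one side
    of them; conversely a sign region is convex, hence connected. *)
Lemma sign_component x : avoid x ->
  connected_component avoid x = [set y | forall i, D i -> 0 < l i x * l i y].
Proof.
move=> ax; apply/seteqP; split=> y /=.
  move=> [S [Sx Savoid Sconn] Sy] i Di.
  have /connected_intervalP itv : connected (l i @` S).
    apply: connected_continuous_connected => //.
    exact/continuous_subspaceT/l_cont.
  rewrite lt_neqAle eq_sym mulf_neq0 ?ax ?(Savoid y Sy) //=.
  rewrite leNgt; apply/negP => neg.
  suff [z Sz z0] : (l i @` S) 0 by have := Savoid z Sz i Di; rewrite z0 eqxx.
  have [xneg|xpos] := ltP (l i x) 0.
    apply: (itv (l i x) (l i y)); [by exists x|by exists y|].
    by rewrite (ltW xneg) /=; rewrite nmulr_rlt0 // in neg; exact: ltW.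
  have {}xpos : 0 < l i x by rewrite lt_neqAle eq_sym ax.
  apply: (itv (l i y) (l i x)); [by exists y|by exists x|].
  by rewrite (ltW xpos) andbT; rewrite pmulr_rlt0 // in neg; exact: ltW.
move=> xy; exists ((fun t : R => x + t *: (y - x)) @` `[0, 1]); last first.
  by exists 1; rewrite /= ?in_itv /= ?ler01 ?lexx // scale1r addrC subrK.
split.
- by exists 0; rewrite /= ?in_itv /= ?ler01 ?lexx // scale0r addr0.
- move=> _ [t /= + <-] i Di; rewrite in_itv /= l_affine => /andP[t0 t1].
  have lx := ax i Di; have lxy := xy i Di.
  apply: contraTneq isT => E.
  have : 0 < l i x * (l i x + t * (l i y - l i x)).
    have -> : l i x * (l i x + t * (l i y - l i x)) =
      (1 - t) * l i x ^+ 2 + t * (l i x * l i y) by ring.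
    have lx2 : 0 < l i x ^+ 2 by rewrite exprn_even_gt0.
    have [->|tpos] := eqVneq t 0; first by rewrite subr0 mul1r mul0r addr0.
    apply: ltr_wpDl; first by rewrite mulr_ge0 ?subr_ge0 ?sqr_ge0.
    by rewrite mulr_gt0 // lt_neqAle eq_sym tpos.
  by rewrite E mulr0 ltxx.
- apply: connected_continuous_connected; first exact: segment_connected.
  exact/continuous_subspaceT/segment_cont.
Qed.

(** Points with weak inequalities are limits of points of the open region, taken
    on the segment towards [x]. *)
Lemma sign_component_closure x : avoid x ->
  closure (connected_component avoid x) =
    [set y | forall i, D i -> 0 <= l i x * l i y].
Proof.
move=> ax; rewrite sign_component //; apply/seteqP; split => y.
  set P := [set y | forall i, D i -> 0 <= l i x * l i y].
  have Pcl : closed P.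
    have -> : P = \bigcap_(i in D)
        ((fun y => l i x * l i y) @^-1` [set r | 0 <= r]).
      by apply/seteqP; split.
    apply: closed_bigI => i Di; apply: preimage_closed; last exact: closed_ge.
    by move=> z _; apply: cvgM; [exact: cvg_cst|exact: l_cont].
  have -> : P y = closure P y by rewrite -(iffLR (closure_id _) Pcl).
  apply: closureS => z pos i Di.
  exact/ltW/pos.
move=> /= nonneg U Uy.
have : \forall t \near 0^'+, U (y + t *: (x - y)).
  have U0 : nbhs (y + (0 : R) *: (x - y)) U by rewrite scale0r addr0.
  exact: (cvg_at_right_filter (@segment_cont y x 0) U0).
move=> nearU; near (0:R)^'+ => t.
exists (y + t *: (x - y)); split; last by near: t.
move=> i Di; rewrite l_affine.
have t0 : 0 < t by near: t; exact: nbhs_right_gt.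
have t1 : t < 1 by near: t; exact: nbhs_right_lt.
have -> : l i x * (l i y + t * (l i x - l i y)) =
  (1 - t) * (l i x * l i y) + t * l i x ^+ 2 by ring.
apply: ltr_wpDl; first by rewrite mulr_ge0 ?nonneg // subr_ge0 ltW.
by rewrite mulr_gt0 // exprn_even_gt0 //= ax.
Unshelve. all: by end_near.
Qed.

End SignRegions.

(** * Lines in the coordinate plane *)

Section PlaneLines.
Set Implicit Arguments.
Unset Strict Implicit.
Import Order.TTheory GRing.Theory Num.Theory numFieldNormedType.Exports.
Local Open Scope classical_set_scope.
Local Open Scope ring_scope.
Context {R : realType} {A B T : nat -> R}.
Notation V := 'rV[R]_2.
Local Notation det2 := (det2 A B).
Local Notation det3 := (det3 A B T).

Definition lin (k : nat) (x : V) : R := A k * x 0 0 + B k * x 0 1 - T k.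

Definition dir (m : nat) : V := \row_j (if j == 0 then B m else - A m).

Lemma rV2P (x y : V) : x 0 0 = y 0 0 -> x 0 1 = y 0 1 -> x = y.
Proof.
move=> e0 e1; apply/rowP => j; have [->|->] : j = 0 \/ j = 1 by
  case: j => -[|[|//]] ?; [left|right]; exact/val_inj.
  by [].
by [].
Qed.

Lemma dotp2E (c x : V) : dotp c x = c 0 0 * x 0 0 + c 0 1 * x 0 1.
Proof.
rewrite /dotp !big_ord_recl big_ord0 addr0.
by congr (_ + _ * _); congr (_ _ _); exact/val_inj.
Qed.

Lemma lin_dir k m x t : lin k (x + t *: dir m) = lin k x + t * det2 k m.
Proof. by rewrite /lin /det2 !mxE /=; ring. Qed.

Definition cross (i j : nat) : V :=
  \row_k ((if k == 0 then T i * B j - T j * B i else A i * T j - A j * T i)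
          / det2 i j).

Lemma lin_cross i j k : det2 i j != 0 ->
  lin k (cross i j) = det3 i j k / det2 i j.
Proof. by move=> d; rewrite /lin !mxE /= /det3; field. Qed.

Lemma lin_affine k x y t :
  lin k (x + t *: (y - x)) = lin k x + t * (lin k y - lin k x).
Proof. by rewrite /lin !mxE; ring. Qed.

Lemma lin_cont k : continuous (lin k).
Proof.
move=> x; have c j : (fun y : V => y 0 j) @ x --> x 0 j.
  exact: coord_continuous.
exact: (cvgB (cvgD (cvgM (cvg_cst (A k)) (c 0)) (cvgM (cvg_cst (B k)) (c 1)))
             (cvg_cst (T k))).
Qed.

Lemma lin_coord i j x : det2 i j != 0 ->
  x = ((lin i x + T i) / det2 i j) *: dir j
    - ((lin j x + T j) / det2 i j) *: dir i.
Proof.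
rewrite /det2 => d.
by apply: rV2P; rewrite /lin !mxE /= /det2; field.
Qed.

Lemma dir_neq0 i j : det2 i j != 0 -> dir i != 0.
Proof.
apply: contraNneq => d0; have := congr1 (fun v : V => v 0 0) d0.
have := congr1 (fun v : V => v 0 1) d0; rewrite !mxE /= /det2.
move=> /eqP; rewrite oppr_eq0.
by move=> /eqP -> ->; rewrite mul0r mulr0 subr0.
Qed.

Lemma small_step N (u v : nat -> R) : exists2 e : R, 0 < e &
  forall k, (k < N)%N -> u k < 0 -> u k + e * `|v k| < 0.
Proof.
elim: N => [|N [e e0 IH]]; first by exists 1.
exists (if u N < 0 then Num.min e (- u N / (`|v N| + 1)) else e).
  case: ifP => // uN; rewrite lt_min e0 divr_gt0 ?oppr_gt0 //.
move=> k; rewrite ltnS leq_eqVlt => /orP[/eqP -> uN|kN uk].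
  rewrite uN -ltrBrDl sub0r.
  have vN : 0 < `|v N| + 1 by rewrite ltr_pwDr.
  apply: (@le_lt_trans _ _ (- u N / (`|v N| + 1) * `|v N|)).
    by rewrite ler_wpM2r // ge_min lexx orbT.
  by rewrite mulrAC -mulrA gtr_pMr ?oppr_gt0 // ltr_pdivrMr // mul1r ltrDl.
apply: le_lt_trans (IH k kN uk); rewrite lerD2l ler_wpM2r //.
by case: ifP => // _; rewrite ge_min lexx.
Qed.

End PlaneLines.

Section Cardinality.
Set Implicit Arguments.
Unset Strict Implicit.
Local Open Scope classical_set_scope.
Local Open Scope card_scope.

Lemma card_le_inj_set (I : finType) (X : {set I}) (W : Type) (S : set W)
    (f : I -> W) N : (N <= #|X|)%N ->
  {in X &, injective f} -> (forall i, i \in X -> S (f i)) -> `I_N #<= S.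
Proof.
move=> NX finj fS; case: N NX => [|N] NX; first by rewrite II0.
have i0 : 'I_#|X| := Ordinal NX.
suff /injfunPex[g] : exists2 g : nat -> W,
    set_fun `I_N.+1 S g & set_inj `I_N.+1 g.
  exact: inj_card_le.
have lt k : (k < N.+1)%N -> (k < #|X|)%N by lia.
exists (fun k => f (enum_val (insubd i0 k))) => [k /= kN|k k'].
  exact/fS/enum_valP.
rewrite !inE /= => kN k'N /finj; rewrite !enum_valP => /(_ isT isT).
by move/enum_val_inj/(congr1 val); rewrite !val_insubd !lt.
Qed.

End Cardinality.

(** * Edges of unbounded cells are external facets *)

Section ExternalFacets.
Set Implicit Arguments.
Unset Strict Implicit.
Import Order.TTheory GRing.Theory Num.Theory numFieldNormedType.Exports.
Local Open Scope classical_set_scope.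
Local Open Scope ring_scope.
Local Open Scope card_scope.
Context {R : realType} {n : nat} {A B T : nat -> R}.
Hypothesis cyc : cyclic_lines n A B T.
Notation V := 'rV[R]_2.
Local Notation det2 := (det2 A B).
Local Notation det3 := (det3 A B T).
Local Notation lin := (@lin R A B T).
Local Notation dir := (@dir R A B).

Lemma ray_unbounded (C : set V) x (v : V) : v != 0 ->
  (forall t, 0 <= t -> C (x + t *: v)) -> ~ bounded_set C.
Proof.
move=> v0 xC [M [Mreal CM]].
have v_gt0 : 0 < `|v| by rewrite normr_gt0.
pose K := `|M| + 1; have MK : M < K by rewrite /K ltr_pwDr // ler_norm.
pose t := (K + `|x| + 1) / `|v|.
have t0 : 0 <= t by rewrite /t divr_ge0 // addr_ge0 // addr_ge0 // /K addr_ge0.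
have le := CM K MK _ (xC t t0).
have : `|t *: v| <= K + `|x|.
  rewrite (_ : t *: v = (x + t *: v) - x); last by rewrite addrC addKr.
  by apply: le_trans (ler_normB _ _) _; rewrite lerD2r.
rewrite normrZ ger0_norm // /t divfK ?gt_eqF // => ?; lra.
Qed.

(** The directions of [i], [- j] and [k] wind around the origin, so a positive
    combination of the three equations is constant and bounds each of them. Two
    of them are coordinates of the plane. *)
Lemma triangle_bounded (C : set V) i j k :
  (i < j)%N -> (j < k)%N -> (k < i + n)%N ->
  (forall x, C x -> [/\ 0 <= lin i x, lin j x <= 0 & 0 <= lin k x]) ->
  bounded_set C.
Proof.
move=> ij jk ki CH.
have dij : 0 < det2 i j by apply: (cyclic_det2 cyc); lia.
have djk : 0 < det2 j k by apply: (cyclic_det2 cyc); lia.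
have dik : 0 < det2 i k by apply: (cyclic_det2 cyc); lia.
pose K := `|det3 i j k|.
have rel x : det2 j k * lin i x + det2 i k * (- lin j x) + det2 i j * lin k x
   = det3 i j k.
  by rewrite /lin /det3 /det2; ring.
have le x : C x -> `|lin i x| <= K / det2 j k /\ `|lin j x| <= K / det2 i k.
  case/CH => hi hj hk; have := rel x.
  have p1 : 0 <= det2 j k * lin i x by rewrite mulr_ge0 // ltW.
  have p2 : 0 <= det2 i k * (- lin j x) by rewrite mulr_ge0 ?oppr_ge0 // ltW.
  have p3 : 0 <= det2 i j * lin k x by rewrite mulr_ge0 // ltW.
  have := ler_norm (det3 i j k); rewrite -/K => q1 q2.
  rewrite ger0_norm // ler0_norm // !ler_pdivlMr // (mulrC _ (det2 j k)).
  by rewrite (mulrC _ (det2 i k)); split; lra.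
exists ((K / det2 j k + `|T i|) / det2 i j * `|dir j|
      + (K / det2 i k + `|T j|) / det2 i j * `|dir i|).
split; first exact: num_real.
move=> M lt x /le[li lj]; apply/ltW/(le_lt_trans _ lt).
rewrite (@lin_coord _ A B T i j x (lt0r_neq0 dij)).
apply: le_trans (ler_normB _ _) _; rewrite !normrZ !normfV (gtr0_norm dij).
apply: lerD; 
  do 2!(apply: ler_wpM2r; first by rewrite ?normr_ge0 // invr_ge0 ltW).
  by apply: le_trans (ler_normD _ _) _; rewrite lerD2r.
by apply: le_trans (ler_normD _ _) _; rewrite lerD2r.
Qed.

(** Three points of a line are never affinely independent, because the
    differences are annihilated by the normal vector of the line. *)
Lemma line_affine_dim (F : set V) m x (e : R) : dir m != 0 -> e != 0 ->
  F x -> F (x + e *: dir m) -> (forall y, F y -> lin m y = 0) ->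
  has_affine_dim F 1.
Proof.
move=> d0 e0 Fx Fxe Fm; split.
  exists (fun i : 'I_2 => if i == 0 then x else x + e *: dir m); split.
    by move=> i; case: ifP.
  rewrite /affinely_independent /row_free.
  set M := (X in \rank X); have -> : M = e *: dir m.
    by apply/rowP => j; rewrite /M !mxE /= ?mxE addrAC subrr add0r.
  by rewrite rank_rV scaler_eq0 (negPf e0) (negPf d0).
move=> p Fp; rewrite /affinely_independent row_free_unit.
apply/negP => U.
set M := (X in X \in unitmx) in U.
pose c : 'cV[R]_2 := \col_j (if j == 0 then A m else B m).
have Mc : M *m c = 0.
  apply/colP => i; rewrite /M !mxE !big_ord_recl big_ord0 !mxE /=.
  have := Fm _ (Fp ord0); have := Fm _ (Fp (lift ord0 i)); rewrite /lin.
  rewrite (_ : lift ord0 ord0 = 1 :> 'I_2); last exact/val_inj.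
  lra.
have c0 : c = 0 by rewrite -(mulKmx U c) Mc mulmx0.
case/eqP: d0; apply/rowP => j; rewrite !mxE.
have := congr1 (fun c : 'cV_2 => c 0 0) c0.
have := congr1 (fun c : 'cV_2 => c 1 0) c0; rewrite !mxE /= => -> ->.
by rewrite oppr0 if_same.
Qed.

(** Each line has a number in every window [r < k <= r + n], so any window may
    serve as index set for describing the cells; the window of [r] is the one
    where [C_r] has all signs negative. *)
Context {H : 'I_n -> set V} {lam : nat -> 'I_n}.
Hypothesis lamH : forall k, H (lam k) = [set x | lin k x = 0].
Hypothesis lam_window : forall r i, exists2 k, (r < k <= r + n)%N & lam k = i.

Definition sign_region r x : set V :=
  [set y | forall k, (r < k <= r + n)%N -> 0 <= lin k x * lin k y].

Lemma arr_complementE r : arr_complement H =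
  [set x | forall k, (r < k <= r + n)%N -> lin k x != 0].
Proof.
apply/seteqP; split=> x /= Hx.
  move=> k _; apply/negP => /eqP kx; apply: Hx; exists (lam k) => //.
  by rewrite lamH.
case=> i _; have [k kr <-] := lam_window r i.
by rewrite lamH /= => /eqP; apply/negP/Hx.
Qed.

Lemma cellE r C : cell H C <->
  exists2 x, (forall k, (r < k <= r + n)%N -> lin k x != 0) &
             C = sign_region r x.
Proof.
rewrite /cell (arr_complementE r).
by split=> -[x Hx ->]; exists x => //;
  rewrite (@sign_component_closure _ _ _ [set k | (r < k <= r + n)%N] lin
    (@lin_cont _ _ _ _) (@lin_affine _ _ _ _) x Hx).
Qed.

Lemma sign_region_eq r x y :
  (forall k, (r < k <= r + n)%N -> 0 < lin k x * lin k y) ->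
  sign_region r x = sign_region r y.
Proof.
move=> xy; apply/seteqP; split=> z /= Hz k kr;
  have := Hz k kr; have := xy k kr;
  have [u0|u0|->] := ltgtP (lin k x) 0; rewrite ?mul0r ?ltxx //;
  rewrite ?(nmulr_rgt0 _ u0) ?(nmulr_rge0 _ u0)
          ?(pmulr_rgt0 _ u0) ?(pmulr_rge0 _ u0) => v0.
- by rewrite (nmulr_rge0 _ v0).
- by rewrite (pmulr_rge0 _ v0).
- by rewrite (nmulr_rge0 _ v0).
- by rewrite (pmulr_rge0 _ v0).
Qed.

(** This is the intersection of the unbounded cell [C_r] with line [m]. *)
Definition zone_edge r m : set V :=
  [set x | lin m x = 0 /\ forall k, (r < k <= r + n)%N -> lin k x <= 0].

(** A point in the relative interior of the edge; its signs tell the two cells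
    that contain the edge from all the others. *)
Definition edge_point r m x := lin m x = 0 /\
  forall k, (r < k <= r + n)%N -> k != m -> lin k x < 0.

(** Only two cells contain an interior point of the edge: [C_r], which contains
    translates of the ray in direction [r], and the cell across line [m], which
    is confined to a triangle with sides on [r], [r + 1] and [m]. *)
Lemma zone_edge_external r m x : (r.+1 < m)%N -> (m < r + n)%N ->
  edge_point r m x -> external_facet H (zone_edge r m).
Proof.
move=> rm mr [mx0 xneg].
have drm : 0 < det2 r m by apply: (cyclic_det2 cyc); lia.
have dir0 : dir r != 0 by apply: (@dir_neq0 _ _ _ _ m); rewrite gt_eqF.
have dirm : dir m != 0.
  by apply: (@dir_neq0 _ _ _ _ r); rewrite det2C oppr_eq0 gt_eqF.
have nudge v : exists2 e : R, 0 < e & forall k, (r < k <= r + n)%N -> k != m ->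
    lin k x + e * v k < 0.
  have [e e0 He] := small_step (r + n).+1 (fun k => lin k x) v.
  exists e => // k kr km; have kN : (k < (r + n).+1)%N by lia.
  apply: le_lt_trans (He k kN (xneg k kr km)).
  by rewrite lerD2l ler_pM2l // ler_norm.
(* Moving backwards along direction [r] leads across line [m]. *)
have [e e0 He] := nudge (det2 r).
pose y := x + (- e) *: dir r.
have yE k : lin k y = lin k x + e * det2 r k.
  by rewrite /y lin_dir [det2 k r]det2C; ring.
have ym : 0 < lin m y by rewrite yE mx0 add0r mulr_gt0.
have yk k : (r < k <= r + n)%N -> k != m -> lin k y < 0.
  by move=> kr km; rewrite yE; exact: He.
have y_cell : cell H (sign_region r y).
  apply/(cellE r); exists y => // k kr.
  have [->|km] := eqVneq k m; first by rewrite gt_eqF.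
  by rewrite lt_eqF // yk.
have mwin : (r < m <= r + n)%N by lia.
have edgeE : zone_edge r m = sign_region r y `&` [set z | lin m z = 0].
  apply/seteqP; split=> z /= [].
    move=> mz0 zneg; split => // k kr.
    have [->|km] := eqVneq k m; first by rewrite mz0 mulr0.
    by rewrite nmulr_rge0 ?zneg // yk.
  move=> zreg mz0; split => // k kr.
  have [->|km] := eqVneq k m; first by rewrite mz0.
  by rewrite -(@nmulr_rge0 _ (lin k y)) ?zreg // yk.
have y_kface : kface 1 (sign_region r y) (zone_edge r m).
  split.
    exists (\row_j (if j == 0 then - A m else - B m)), (- T m); split.
      move=> z /(_ m mwin); rewrite pmulr_rge0 // dotp2E !mxE /= /lin; lra.
    rewrite edgeE; congr (_ `&` _); apply/seteqP; split=> z /=;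
      rewrite dotp2E !mxE /= /lin; lra.
  have [e' e'0 He'] := nudge (fun k => det2 k m).
  apply: (@line_affine_dim _ m x e') => //; first by rewrite gt_eqF.
  - split => // k kr; have [->|km] := eqVneq k m; first by rewrite mx0.
    by rewrite ltW // xneg.
  - have dmm : det2 m m = 0 by rewrite /det2; ring.
    split; first by rewrite lin_dir mx0 dmm mulr0 addr0.
    move=> k kr; rewrite lin_dir; have [->|km] := eqVneq k m.
      by rewrite mx0 dmm mulr0 addr0.
    by rewrite ltW // He'.
  - by move=> z [].
split.
  by exists (sign_region r y).
exists (sign_region r y); split.
  split => //.
  apply: (@triangle_bounded _ r r.+1 m) => // z zreg; split.
  - have rn : (r + n != m)%N by lia.
    have rnw : (r < r + n <= r + n)%N by lia.
    have := zreg (r + n)%N rnw; rewrite (nmulr_rge0 _ (yk _ rnw rn)).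
    by rewrite /lin (cyclicA cyc) (cyclicB cyc) (cyclicT cyc); lra.
  - have r1 : (r.+1 != m)%N by lia.
    have r1w : (r < r.+1 <= r + n)%N by lia.
    by have := zreg r.+1 r1w; rewrite (nmulr_rge0 _ (yk _ r1w r1)).
  - by have := zreg m mwin; rewrite pmulr_rge0.
move=> C' [/(cellE r)[x' x'neq ->] bnd [[c [b [_ FE]]] _]].
have Fx : zone_edge r m x.
  split => // k kr; have [->|km] := eqVneq k m; first by rewrite mx0.
  by rewrite ltW // xneg.
rewrite FE in Fx; case: Fx => xreg _.
have x'neg k : (r < k <= r + n)%N -> k != m -> lin k x' < 0.
  move=> kr km; rewrite lt_neqAle x'neq //=.
  by have := xreg k kr; rewrite (nmulr_lge0 _ (xneg k kr km)).
apply/esym; case: (ltgtP (lin m x') 0) => x'm; last first.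
- by have := x'neq m mwin; rewrite x'm eqxx.
- apply: sign_region_eq => k kr; have [->|km] := eqVneq k m.
    by rewrite mulr_gt0.
  by rewrite nmulr_lgt0 ?x'neg // yk.
(* The cell with all signs negative contains a ray in direction [r]. *)
exfalso; apply: (@ray_unbounded _ x' (dir r) dir0 _ bnd) => t t0 k kr.
have neg : lin k x' < 0 by have [->//|km] := eqVneq k m; exact: x'neg.
rewrite nmulr_rge0 // lin_dir.
have : 0 <= t * det2 r k.
  apply: mulr_ge0 => //; have [->|krn] := eqVneq k (r + n)%N.
    by rewrite (det2_addn cyc) /det2 subrr oppr0.
  by apply/ltW/(cyclic_det2 cyc); lia.
by rewrite [det2 k r]det2C; lra.
Qed.

(** From a vertex [p] of the edge, on the lines [m] and [k0], a small move along
    [m] into the negative side of [k0] reaches the interior of the edge. *)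
Lemma edge_point_nudge r m k0 s p :
  lin m p = 0 -> lin k0 p = 0 -> s * det2 k0 m < 0 ->
  (forall k, (r < k <= r + n)%N -> k != m -> k != k0 -> lin k p < 0) ->
  exists x, edge_point r m x.
Proof.
move=> mp k0p sk0 neg.
have [e e0 He] := small_step (r + n).+1 (fun k => lin k p)
  (fun k => s * det2 k m).
exists (p + (e * s) *: dir m); split.
  by rewrite lin_dir mp /det2 subrr mulr0 addr0.
move=> k kr km; rewrite lin_dir -mulrA; have [->|kk0] := eqVneq k k0.
  by rewrite k0p add0r pmulr_rlt0.
have kN : (k < (r + n).+1)%N by lia.
apply: le_lt_trans (He k kN (neg k kr km kk0)).
by rewrite lerD2l ler_pM2l // ler_norm.
Qed.

(** The boundary of [C_r] leaves the ray of [r] along line [m], in direction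
    [m]. *)
Lemma edge_point_first r m :
  @last_crossing R n A B T r m -> exists x, edge_point r m x.
Proof.
move=> [rm mr Hm]; have d : 0 < det2 r m by exact: (cyclic_det2 cyc).
have E k := @lin_cross R A B T r m k (lt0r_neq0 d).
apply: (@edge_point_nudge r m (r + n)%N 1 (@cross R A B T r m)).
- by rewrite E /det3 /det2; ring.
- by rewrite E (det3_addn cyc) /det3 /det2; ring.
- by rewrite mul1r [det2 (r + n) m]det2C (det2_addn cyc) opprK det2C oppr_lt0.
- by move=> k kr km kn; rewrite E pmulr_llt0 ?invr_gt0 // Hm //; lia.
Qed.

(** The boundary of [C_r] arrives at the ray of [r + 1] along line [m], still in
    direction [m]; the edge lies behind the crossing. *)
Lemma edge_point_last r m :
  @last_crossing R n A B T r.+1 m -> exists x, edge_point r m x.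
Proof.
move=> [rm mr Hm]; have d : 0 < det2 r.+1 m by exact: (cyclic_det2 cyc).
have E k := @lin_cross R A B T r.+1 m k (lt0r_neq0 d).
apply: (@edge_point_nudge r m r.+1 (-1) (@cross R A B T r.+1 m)).
- by rewrite E /det3 /det2; ring.
- by rewrite E /det3 /det2; ring.
- by rewrite mulN1r oppr_lt0.
- by move=> k kr km kn; rewrite E pmulr_llt0 ?invr_gt0 // Hm //; lia.
Qed.

Lemma zone_edge_same r m m' : (r < m' <= r + n)%N ->
  (exists x, edge_point r m x) -> zone_edge r m = zone_edge r m' -> m = m'.
Proof.
move=> m'r [x [mx neg]] E; have : zone_edge r m x.
  by split=> // k kr; have [->|/(neg k kr)/ltW//] := eqVneq k m; rewrite mx.
rewrite E => -[m'x _]; apply/eqP/negPn/negP; rewrite eq_sym => mm'.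
by have := neg m' m'r mm'; rewrite m'x ltxx.
Qed.

(** An interior point of an edge of [C_r] has one zero sign only. The lines
    [r + 1] and [r + n] are not the line of the edge, and for every other
    unbounded cell at least one of them occurs in the window with the opposite
    orientation. *)
Lemma zone_edge_neq r r' m m' : (r < r')%N -> (r' < r + 2 * n)%N ->
  (r.+1 < m)%N -> (m < r + n)%N -> (exists x, edge_point r m x) ->
  zone_edge r m <> zone_edge r' m'.
Proof.
move=> rr' r'r rm mr [x [mx neg]] E; have : zone_edge r m x.
  by split=> // k kr; have [->|/(neg k kr)/ltW//] := eqVneq k m; rewrite mx.
have linN k : lin (k + n) x = - lin k x.
  by rewrite /lin (cyclicA cyc) (cyclicB cyc) (cyclicT cyc); ring.
rewrite E => -[_ nonpos]; have [le|gt] := leqP r' (r + n).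
  have neg' : lin r.+1 x < 0 by apply: neg; lia.
  have k_in : (r' < r.+1 + n <= r' + n)%N by lia.
  by have := nonpos _ k_in; rewrite linN oppr_le0 leNgt neg'.
have neg' : lin (r + n) x < 0 by apply: neg; lia.
have k_in : (r' < r + n + n <= r' + n)%N by lia.
by have := nonpos _ k_in; rewrite linN oppr_le0 leNgt neg'.
Qed.

Lemma card_external_facets : (4 <= n)%N ->
  `I_(2 * (n - 1)) #<= [set F | external_facet H F].
Proof.
move=> n4; have n1 : (1 < n)%N by lia.
have [phi phiP] := choice (fun r => last_crossing_exists cyc r n1).
(* The pair [(r, false)] stands for the first bounded edge of [C_r] and
   [(r, true)] for the last one, when it is on another line. *)
pose X := [set p : 'I_(2 * n) * bool | (phi p.1 != p.1.+1) &&
  (p.2 ==> (phi p.1 != phi p.1.+1))]%SET.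
pose mu (p : 'I_(2 * n) * bool) := if p.2 then phi p.1.+1 else phi p.1.
pose edge (p : 'I_(2 * n) * bool) := zone_edge p.1 (mu p).
have muP p : p \in X -> [/\ (p.1.+1 < mu p)%N, (mu p < p.1 + n)%N &
    exists x, edge_point p.1 (mu p) x].
  rewrite inE /mu => /andP[nw _]; have [h1 h2 _] := phiP p.1.
  have [h3 h4 _] := last_crossing_antitone cyc (phiP p.1) (phiP p.1.+1) nw.
  case: p.2; split => //.
  - exact: edge_point_last (phiP _).
  - by rewrite ltn_neqAle eq_sym nw.
  - exact: edge_point_first (phiP _).
apply: (@card_le_inj_set _ X _ _ edge).
- apply: leq_trans (bounded_edge_count cyc n4 phiP) _.
  have -> : #|X| = (\sum_(r < 2 * n) \sum_(c : bool) ((r, c) \in X))%N.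
    rewrite pair_bigA -sum1_card big_mkcond.
    by apply: eq_bigr => -[r c] _ /=; case: ifP.
  apply: leq_sum => r _; rewrite big_bool !inE /= andbT.
  by case: (phi r != r.+1); case: (phi r != phi r.+1).
- move=> p p' pX p'X; have [m1 m2 m3] := muP p pX.
  have [m1' m2' m3'] := muP p' p'X; rewrite /edge => E.
  have lt := ltn_ord p.1; have lt' := ltn_ord p'.1.
  have [pp'|p'p|pp'] := ltngtP p.1 p'.1.
  + by case: (zone_edge_neq pp' (ltn_addl _ lt') m1 m2 m3 E).
  + by case: (zone_edge_neq p'p (ltn_addl _ lt) m1' m2' m3' (esym E)).
  have mm : mu p = mu p'.
    apply: (zone_edge_same _ m3); last by rewrite E -pp'.
    rewrite -pp' in m1' m2'.
    by rewrite (ltn_trans _ m1') //= ltnW.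
  move=> {m1 m2 m3 m1' m2' m3' E lt lt'}.
  move: pX p'X mm; rewrite !inE /mu.
  case: p p' pp' => r c [r' c'] /= /val_inj <-.
  by case: c c' => -[] //= /andP[_ ne] /andP[_ ne'] eq_phi;
    rewrite ?eq_phi eqxx in ne ne'.
- move=> p /muP[m1 m2 [x xP]].
  exact: (zone_edge_external m1 m2 xP).
Qed.

End ExternalFacets.

(** * From a simple arrangement to a cyclic list of lines *)

Section AngularSort.
Set Implicit Arguments.
Unset Strict Implicit.
Import Order.TTheory GRing.Theory Num.Theory.
Local Open Scope ring_scope.
Context {R : realType}.

(** The normal vectors with angle in a half-open half turn, where comparing
    angles by the sign of [det2] is transitive. *)
Definition right_half (a b : R) : bool := (0 < a) || ((a == 0) && (0 < b)).

Lemma right_half_sign (a b : R) : (a, b) != (0, 0) ->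
  exists2 s : R, s != 0 & right_half (s * a) (s * b).
Proof.
rewrite xpair_eqE negb_and /right_half.
have [a0|a0|->] := ltgtP a 0.
- by exists (-1); rewrite ?oppr_eq0 ?oner_eq0 // !mulN1r oppr_gt0 a0.
- by exists 1; rewrite ?oner_eq0 // !mul1r a0.
rewrite /= => b0; have [bneg|] := ltP b 0.
  exists (-1); rewrite ?oppr_eq0 ?oner_eq0 // !mulN1r oppr0 eqxx oppr_gt0.
  by rewrite bneg orbT.
move=> bpos; exists 1; rewrite ?oner_eq0 // !mul1r eqxx.
by rewrite (lt_neqAle 0 b) eq_sym b0 bpos orbT.
Qed.

Lemma right_half_trans (a b a' b' a'' b'' : R) :
  right_half a b -> right_half a' b' -> right_half a'' b'' ->
  0 <= a * b' - a' * b -> 0 <= a' * b'' - a'' * b' ->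
  0 <= a * b'' - a'' * b.
Proof.
have nonneg x y : right_half x y -> 0 <= x.
  by case/orP => [/ltW//|/andP[/eqP-> _]].
move=> u u' u'' h1 h2; have [x0 x0''] := (nonneg _ _ u, nonneg _ _ u'').
(* Grassmann-Plucker relation for the three vectors and the second axis. *)
case/orP: u' => [a'0|/andP[/eqP a'0 b'0]].
  rewrite -(pmulr_rge0 _ a'0).
  have -> : a' * (a * b'' - a'' * b) =
    a * (a' * b'' - a'' * b') + a'' * (a * b' - a' * b) by ring.
  by rewrite addr_ge0 // mulr_ge0.
move: h2; rewrite a'0 mul0r sub0r oppr_ge0 pmulr_lle0 // => a''0.
have E : a'' = 0 by apply/eqP; rewrite eq_le a''0.
move: u''; rewrite /right_half E ltxx eqxx /= => b''0.
by rewrite mul0r subr0 mulr_ge0 // ltW.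
Qed.

(** Orient all lines so that their normal vectors are in [right_half], sort them
    by angle, and continue the list periodically, reversing the orientation
    after each period. *)
Lemma angular_sort n (a b t : 'I_n -> R) : (1 < n)%N ->
  (forall i, (a i, b i) != (0, 0)) ->
  (forall i j, i != j -> det2 a b i j != 0) ->
  (forall i j k, i != j -> j != k -> i != k -> det3 a b t i j k != 0) ->
  exists (lam : nat -> 'I_n) (s : nat -> R),
  [/\ forall k, s k != 0,
      forall r i, exists2 k, (r < k <= r + n)%N & lam k = i
    & cyclic_lines n (fun k => s k * a (lam k)) (fun k => s k * b (lam k))
        (fun k => s k * t (lam k))].
Proof.
move=> n1 nz par conc.
have n0 : (0 < n)%N by lia.
have /choice[eps epsP] : forall i, exists eps : R,
    eps != 0 /\ right_half (eps * a i) (eps * b i).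
  by move=> i; have [eps] := right_half_sign (nz i); exists eps.
have eps0 i := (epsP i).1; have epsU i := (epsP i).2.
pose cr := det2 (fun i => eps i * a i) (fun i => eps i * b i).
have crE i j : cr i j = eps i * eps j * det2 a b i j.
  by rewrite /cr /det2; ring.
have crN i j : cr j i = - cr i j by rewrite /cr det2C.
pose leT i j := 0 <= cr i j.
have leT_total : total leT.
  by move=> i j; rewrite /leT (crN i j) oppr_ge0; exact: le_total.
have leT_trans : transitive leT.
  by move=> j i k; apply: right_half_trans.
pose l := sort leT (enum 'I_n).
have l_size : size l = n by rewrite size_sort size_enum_ord.
have l_uniq : uniq l by rewrite sort_uniq enum_uniq.
pose i0 : 'I_n := Ordinal n0.
pose lam k := nth i0 l (k %% n).
have lam_neq i j : (i < j)%N -> (j < i + n)%N -> lam i != lam j.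
  move=> ij ji; rewrite nth_uniq ?l_size ?ltn_mod //.
  apply/negP; rewrite eq_sym eqn_mod_dvd; last lia.
  by move/dvdn_leq; lia.
have lam_lt p q : (p < q)%N -> (q < n)%N -> 0 < cr (nth i0 l p) (nth i0 l q).
  move=> pq qn; rewrite lt_neqAle eq_sym; apply/andP; split.
    rewrite crE !mulf_neq0 // par // nth_uniq ?l_size //; lia.
  apply: (sorted_ltn_nth leT_trans) => //; first exact: sort_sorted.
  - by rewrite inE l_size; lia.
  - by rewrite inE l_size.
pose s k : R := (-1) ^+ (k %/ n) * eps (lam k).
have s0 k : s k != 0 by rewrite mulf_neq0 // expf_neq0 // oppr_eq0 oner_eq0.
have sS k : s (k + n)%N = - s k.
  by rewrite /s /lam modnDr divnDr // divnn n0 addn1 exprS; ring.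
have lamS k : lam (k + n)%N = lam k by rewrite /lam modnDr.
exists lam, s; split => //.
  move=> r i.
  have il : (index i l < n)%N.
    by rewrite -[X in (_ < X)%N]l_size index_mem mem_sort mem_enum.
  have [q [lb ub]] : exists q,
      (r < index i l + q * n)%N /\ (index i l + q * n <= r + n)%N.
    have [le|lt] := leqP (index i l) r.
      exists ((r - index i l) %/ n).+1.
      have := divn_eq (r - index i l) n.
      by have := ltn_pmod (r - index i l) n0; rewrite mulSn; lia.
    by exists 0%N; lia.
  exists (index i l + q * n)%N; first by rewrite lb.
  by rewrite /lam addnC modnMDl modn_small // nth_index // mem_sort mem_enum.
split => [k|k|k|i j ij ji|i j k ij jk ki]; rewrite ?sS ?lamS ?mulNr //.
  have -> : det2 (fun k => s k * a (lam k)) (fun k => s k * b (lam k)) i j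
    = (-1) ^+ (i %/ n + j %/ n) * cr (lam i) (lam j).
    by rewrite /cr /det2 /s exprD; ring.
  have := divn_eq i n; have := divn_eq j n.
  have := ltn_pmod i n0; have := ltn_pmod j n0; rewrite /lam.
  move: (i %% n)%N (j %% n)%N (i %/ n)%N (j %/ n)%N => p p' q q' p'n pn jE iE.
  (* Either [i] and [j] are in the same period, or [j] is in the next one and
     comes earlier in the sorted list. *)
  have [qq|qq] : (q' = q \/ q' = q.+1)%N by nia.
    by rewrite qq addnn -signr_odd odd_double mul1r lam_lt //; lia.
  rewrite qq addnS exprS addnn -signr_odd odd_double mulr1 mulN1r -crN.
  by apply: lam_lt => //; nia.
have -> : det3 (fun k => s k * a (lam k)) (fun k => s k * b (lam k))
    (fun k => s k * t (lam k)) i j k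
  = s i * s j * s k * det3 a b t (lam i) (lam j) (lam k).
  by rewrite /det3 /det2; ring.
apply: mulf_neq0; first by apply: mulf_neq0 (s0 k); apply: mulf_neq0.
by apply: conc; apply: lam_neq; lia.
Qed.

End AngularSort.

Section SimpleArrangement.
Set Implicit Arguments.
Unset Strict Implicit.
Import Order.TTheory GRing.Theory Num.Theory numFieldNormedType.Exports.
Local Open Scope classical_set_scope.
Local Open Scope ring_scope.
Context {R : realType}.

(** Parallel lines would meet in no point or in a whole line, and three
    concurrent lines would give two pairs with the same meeting point. *)
Lemma simple_arrangement_lines n (H : 'I_n -> set 'rV[R]_2) :
  simple_arrangement H -> exists a b t : 'I_n -> R,
  [/\ forall i, H i = [set x | a i * x 0 0 + b i * x 0 1 = t i],
      forall i, (a i, b i) != (0, 0),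
      forall i j, i != j -> det2 a b i j != 0
    & forall i j k, i != j -> j != k -> i != k -> det3 a b t i j k != 0].
Proof.
move=> [[Hhyp _] _ Hpt Hdist].
have /choice[c cP] : forall i, exists c : 'rV[R]_2, exists t, c != 0 /\
  H i = [set x | dotp c x = t] by [].
have /choice[t tP] := cP.
pose a i := c i 0 0; pose b i := c i 0 1.
have HE i : H i = [set x | a i * x 0 0 + b i * x 0 1 = t i].
  by rewrite (tP i).2; apply/seteqP; split=> x /=; rewrite dotp2E.
have nz i : (a i, b i) != (0, 0).
  apply: contraNneq (tP i).1 => -[a0 b0].
  by apply/eqP/rV2P; rewrite !mxE.
have meetE i j x : meet_of H [set i; j]%SET x <-> H i x /\ H j x.
  split=> [m|[hi hj] k /=].
    by split; apply: m; rewrite /= !inE eqxx ?orbT.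
  by rewrite !inE => /orP[]/eqP->.
have pt i j : i != j -> exists x, meet_of H [set i; j]%SET = [set x].
  by move=> ij; apply: Hpt; rewrite cards2 ij.
have par i j : i != j -> det2 a b i j != 0.
  move=> ij; rewrite /det2; apply/negP => /eqP D0; have [x xE] := pt i j ij.
  have [xi xj] : H i x /\ H j x by apply/meetE; rewrite xE.
  pose v : 'rV[R]_2 := \row_k (if k == 0 then b i else - a i).
  have : meet_of H [set i; j]%SET (x + v).
    by apply/meetE; move: xi xj; rewrite !HE /= !mxE /=; split; lra.
  rewrite xE /= => /eqP; rewrite -subr_eq0 addrC addKr => /eqP v0.
  have := congr1 (fun v : 'rV_2 => v 0 0) v0.
  have := congr1 (fun v : 'rV_2 => v 0 1) v0; rewrite !mxE /= => /eqP.
  rewrite oppr_eq0 => /eqP a0 b0.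
  by have := nz i; rewrite a0 b0 eqxx.
exists a, b, t; split => // i j k ij jk ik; apply/negP => /eqP D0.
have [x xE] := pt i j ij; have [y yE] := pt j k jk.
have [xi xj] : H i x /\ H j x by apply/meetE; rewrite xE.
have xk : H k x.
  move: xi xj; rewrite !HE /= => xi xj.
  apply: (mulIf (par i j ij)); apply/eqP; rewrite -subr_eq0 -[X in _ == X]D0.
  by apply/eqP; rewrite /det3 /det2 -xi -xj; ring.
apply: (Hdist [set i; j]%SET [set j; k]%SET); rewrite ?cards2 ?ij ?jk //.
  apply/negP => /eqP /setP /(_ i); rewrite !inE eqxx (negPf ij).
  by rewrite (negPf ik).
have : meet_of H [set j; k]%SET x by apply/meetE.
by rewrite xE yE /= => ->.
Qed.

End SimpleArrangement.

Import Order.TTheory GRing.Theory Num.Theory.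
Local Open Scope classical_set_scope.
Local Open Scope card_scope.

Theorem proposition2p1 (R : realType) (n : nat) (H : 'I_n -> set 'rV[R]_2) :
  (4 <= n)%N -> simple_arrangement H ->
  `I_(2 * (n - 1)) #<= [set F | external_facet H F].
Proof.
move=> n4 /simple_arrangement_lines[a [b [t [HE nz par conc]]]].
have n1 : (1 < n)%N by lia.
have [lam [s [s0 lam_window cyc]]] := angular_sort n1 nz par conc.
set A := fun k => (s k * a (lam k))%R in cyc.
set B := fun k => (s k * b (lam k))%R in cyc.
set T := fun k => (s k * t (lam k))%R in cyc.
have lamH k : H (lam k) = [set x | @lin R A B T k x = 0%R].
  have E x : (@lin R A B T k x = s k *
      (a (lam k) * x 0 0 + b (lam k) * x 0 1 - t (lam k)))%R.
    by rewrite /lin /A /B /T; ring.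
  rewrite HE; apply/seteqP; split=> x /=; rewrite E.
    by move=> ->; rewrite subrr mulr0.
  by move/eqP; rewrite mulf_eq0 (negPf (s0 k)) subr_eq0 => /eqP.
exact: (card_external_facets cyc lamH lam_window n4).
Qed.
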